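(* Let $X\subset\mathbb{R}^n$ and $U\subset\mathbb{R}^m$ be compact, let $f:\mathbb{R}^n\times U\to\mathbb{R}^n$ and $g:\mathbb{R}^n\times U\to\mathbb{R}$ be bounded, continuous, and Lipschitz in $x$ uniformly in $u$, let $\lambda>0$ and $x_0\in X$. If the linear program defining $\mathcal{J}(x_0)$ is feasible, i.e. there exists $\mu\in\mathcal{M}(X\times U)^+$ with $A^*\mu=\delta_{x_0}$, then there is no duality gap: $$\mathcal{J}^*(x_0)=\mathcal{J}(x_0).$$
   Context: $C(\mathcal{X})$ denotes the Banach space of real-valued bounded continuous functions on $\mathcal{X}$ with the sup-norm $\|\cdot\|_\infty$. $\mathcal{M}(X\times U)$ is the space of finite signed Borel measures on $X\times U$, $\mathcal{M}(X\times U)^+$ is the cone of finite nonnegative Borel measures on $X\times U$, and $\langle\mu,l\rangle=\int_{X\times U} l\,d\mu$ for $l\in C(X\times U)$. $C^1(X)$ is the Banach space $$C^1(X)=\Big\{\phi\in C(X):\ \frac{\partial\phi}{\partial x_i}\in C(X)\ \text{for all } i=1,\ldots,n\Big\},\qquad \|\phi\|^1_\infty=\|\phi\|_\infty+\sum_{i=1}^n\Big\|\frac{\partial\phi}{\partial x_i}\Big\|_\infty.$$ The bounded linear operator $A:C^1(X)\to C(X\times U)$ is $(A\phi)(x,u)=\lambda\phi(x)-\nabla_x\phi(x)\cdot f(x,u)$ for $(x,u)\in X\times U$, and $A^*:\mathcal{M}(X\times U)\to C^1(X)^*$ is its adjoint, $\langle A^*\mu,\phi\rangle=\langle\mu,A\phi\rangle$.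 The Dirac measure $\delta_{x_0}$ is identified with the element $\phi\mapsto\phi(x_0)$ of $C^1(X)^*$, so $A^*\mu=\delta_{x_0}$ means $\int_{X\times U}A\phi\,d\mu=\phi(x_0)$ for all $\phi\in C^1(X)$. Define $$\mathcal{J}(x_0)=\inf\{\langle\mu,g\rangle:\ \mu\in\mathcal{M}(X\times U)^+,\ A^*\mu=\delta_{x_0}\},$$ $$\mathcal{J}^*(x_0)=\sup\{\phi(x_0):\ \phi\in C^1(X),\ A\phi\le g\ \text{on } X\times U\}.$$ *)

(* Defs.v *)
From mathcomp Require Import all_boot all_order all_algebra.
From mathcomp Require Import all_classical all_reals all_analysis.

Set Implicit Arguments.
Unset Strict Implicit.
Unset Printing Implicit Defensive.

Import Order.TTheory GRing.Theory Num.Theory.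
Import numFieldNormedType.Exports.

Local Open Scope classical_set_scope.
Local Open Scope ring_scope.

(* R^n * R^m with its Borel sigma-algebra. *)
Notation borel_space R n m :=
  (g_sigma_algebraType (open : set (set ('rV[R]_n * 'rV[R]_m)%type))).

(* Only the values on R^n * U matter. The norm on R^n is the sup norm, which
   changes the Lipschitz constant but not the Lipschitz property. *)
Definition bounded_continuous_lipschitz (R : realType) (n m : nat)
    (V : normedModType R) (U : set 'rV[R]_m)
    (h : 'rV[R]_n * 'rV[R]_m -> V) : Prop :=
  [/\ [bounded h z | z in setT `*` U],
      {within setT `*` U, continuous h} &
      exists L : R, forall u, U u -> L.-lipschitz (fun x => h (x, u))].

(* C^1(X) for an arbitrary compact X, which may have boundary points or an
   empty interior: phi and its partial derivatives exist and are continuous on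
   some open neighbourhood of X. Elements are ambient functions rather than
   functions on X, so that the partial derivatives at points of X are genuine
   two-sided ones. *)
Definition C1 (R : realType) (n : nat) (X : set 'rV[R]_n) :
    set ('rV[R]_n -> R) :=
  [set phi | exists2 O : set 'rV[R]_n, open O /\ X `<=` O &
    forall x, O x ->
      {for x, continuous phi} /\
      forall i : 'I_n, derivable phi x 'e_i /\
                       {for x, continuous ('D_('e_i) phi)}].

(* (A phi)(x, u) = lambda phi(x) - grad phi(x) . f(x, u) *)
Definition opA (R : realType) (n m : nat) (lambda : R)
    (f : 'rV[R]_n * 'rV[R]_m -> 'rV[R]_n) (phi : 'rV[R]_n -> R)
    (z : 'rV[R]_n * 'rV[R]_m) : R :=
  lambda * phi z.1 - \sum_(i < n) 'D_('e_i) phi z.1 * f z 0 i.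

(* A finite nonnegative Borel measure on K = X * U is encoded as a finite
   Borel measure on R^n * R^m that vanishes outside K. *)
Definition measures_on (R : realType) (n m : nat)
    (K : set ('rV[R]_n * 'rV[R]_m)) :
    set {finite_measure set (borel_space R n m) -> \bar R} :=
  [set mu | mu (~` K) = 0%E].

Definition pairing (R : realType) (n m : nat)
    (K : set ('rV[R]_n * 'rV[R]_m))
    (mu : {finite_measure set (borel_space R n m) -> \bar R})
    (l : 'rV[R]_n * 'rV[R]_m -> R) : \bar R :=
  (\int[mu]_(z in K) (l z)%:E)%E.

(* A^* mu, as a functional on C^1(X). *)
Definition adjointA (R : realType) (n m : nat)
    (X : set 'rV[R]_n) (U : set 'rV[R]_m) (lambda : R)
    (f : 'rV[R]_n * 'rV[R]_m -> 'rV[R]_n)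
    (mu : {finite_measure set (borel_space R n m) -> \bar R})
    (phi : 'rV[R]_n -> R) : \bar R :=
  pairing (X `*` U) mu (opA lambda f phi).

(* The feasible set of the primal program: A^* mu = delta_{x0} in C^1(X)^*. *)
Definition feasible (R : realType) (n m : nat)
    (X : set 'rV[R]_n) (U : set 'rV[R]_m) (lambda : R)
    (f : 'rV[R]_n * 'rV[R]_m -> 'rV[R]_n) (x0 : 'rV[R]_n) :
    set {finite_measure set (borel_space R n m) -> \bar R} :=
  [set mu | measures_on (X `*` U) mu /\
    forall phi, C1 X phi -> adjointA X U lambda f mu phi = (phi x0)%:E].

Definition primal_value (R : realType) (n m : nat)
    (X : set 'rV[R]_n) (U : set 'rV[R]_m) (lambda : R)
    (f : 'rV[R]_n * 'rV[R]_m -> 'rV[R]_n)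
    (g : 'rV[R]_n * 'rV[R]_m -> R) (x0 : 'rV[R]_n) : \bar R :=
  ereal_inf [set pairing (X `*` U) mu g | mu in feasible X U lambda f x0].

Definition dual_value (R : realType) (n m : nat)
    (X : set 'rV[R]_n) (U : set 'rV[R]_m) (lambda : R)
    (f : 'rV[R]_n * 'rV[R]_m -> 'rV[R]_n)
    (g : 'rV[R]_n * 'rV[R]_m -> R) (x0 : 'rV[R]_n) : \bar R :=
  ereal_sup [set (phi x0)%:E | phi in
    [set phi | C1 X phi /\
      forall z, (X `*` U) z -> opA lambda f phi z <= g z]].

(* Main.v *)
Require Import Defs.
From HB Require Import structures.
From mathcomp Require Import all_boot all_order all_algebra finmap.
From mathcomp Require Import all_classical all_reals all_analysis.
From mathcomp Require Import measurable_realfun lra ring.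

Set Implicit Arguments.
Unset Strict Implicit.
Unset Printing Implicit Defensive.

Import Order.TTheory GRing.Theory Num.Theory.
Import numFieldNormedType.Exports.

Local Open Scope classical_set_scope.
Local Open Scope ring_scope.

(* Let v be the dual value. Feasibility of the primal program makes
   p(h) = inf {s v + phi(x0) : s >= 0, phi in C^1(X), h <= s g + A phi on X * U}
   a finite sublinear functional on the bounded functions on X * U, and any
   linear functional L <= p is positive, satisfies L(A phi) = phi(x0) for all
   phi, and L(g) <= v. By Hahn-Banach such an L exists, and by the
   Riesz representation theorem it is integration against a measure mu on
   X * U, which is therefore feasible with <mu, g> <= v.

   For the Riesz theorem, L is available on all bounded functions, hence on
   indicators: nu(E) = L(1_E) is finitely additive, and the outer measure
   generated by nu on open covers is a metric outer measure. *)

(** * The Hahn-Banach theorem *)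

(** Homogeneity is only an inequality for [a > 0]; applied to [a^-1] it gives the equality, and
    [a = 2^-1] together with subadditivity gives [q 0 = 0]. *)
Definition sublinear (R : realType) (V : lmodType R) (q : V -> R) :=
  (forall x y, q (x + y) <= q x + q y) /\
  (forall a x, 0 < a -> q (a *: x) <= a * q x).

Lemma sublinear0 (R : realType) (V : lmodType R) (q : V -> R) :
  sublinear q -> q 0 = 0.
Proof.
move=> [qD qZ].
have := qD 0 0; rewrite addr0 => h1.
have h2 : 0 < 2^-1 :> R by [].
have := qZ _ 0 h2; rewrite scaler0 => h3.
by apply/eqP; rewrite eq_le; apply/andP; split; lra.
Qed.

Lemma sublinear_oppr_ge (R : realType) (V : lmodType R) (q : V -> R) x :
  sublinear q -> - q (- x) <= q x.
Proof.
move=> sq; have := sublinear0 sq; case: sq => qD _.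
by have := qD x (- x); rewrite subrr; lra.
Qed.

(** For fixed [y], the infimum over [t >= 0] of [q (z + t *: y) - t * q y] is sublinear in [z] and
    below [q], hence equal to [q] by minimality. The choice [t = 1] then makes [q] superadditive. *)
Lemma minimal_sublinear_linear (R : realType) (V : lmodType R) (q : V -> R) :
  sublinear q ->
  (forall r, sublinear r -> (forall x, r x <= q x) -> r = q) ->
  forall a x y, q (a *: x + y) = a * q x + q y.
Proof.
move=> sq qmin; have q0 := sublinear0 sq; have [qD qZ] := sq.
have super x y : q x + q y <= q (x + y).
  pose E z := [set q (z + t *: y) - t * q y | t in [set t | 0 <= t]].
  (* The infimum is finite because [t * q y <= q (t *: y) <= q (z + t *: y) + q (- z)]. *)
  have lbE z : lbound (E z) (- q (- z)).
    move=> _ [t t0 <-].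
    have h1 : t * q y <= q (t *: y).
      move: t0; rewrite /= le_eqVlt => /predU1P[<-|t0].
        by rewrite scale0r q0 mul0r.
      have ti : 0 < t^-1 by rewrite invr_gt0.
      have := qZ _ (t *: y) ti.
      rewrite scalerA mulVf ?gt_eqF// scale1r.
      by rewrite -ler_pdivrMl ?invr_gt0// invrK.
    have h2 := qD (z + t *: y) (- z).
    by move: h2; rewrite addrC addrA (addrC (- z)) subrr add0r; lra.
  have hlE z : has_lbound (E z) by exists (- q (- z)); exact: lbE.
  have E_q z : E z (q z).
    by exists 0 => /=; rewrite // scale0r addr0 mul0r subr0.
  have hiE z : has_inf (E z) by split => //; exists (q z).
  have srr : sublinear (fun z => inf (E z)).
    split=> [z w|a z a0].
      apply/ler_addgt0Pr => e e0; have e2 : 0 < e / 2 by rewrite divr_gt0.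
      have [_ [t /= t0 <-] ht] := inf_adherent e2 (hiE z).
      have [_ [s /= s0 <-] hs] := inf_adherent e2 (hiE w).
      have : inf (E (z + w)) <= q ((z + w) + (t + s) *: y) - (t + s) * q y.
        by apply: ge_inf => //; exists (t + s) => //=; rewrite addr_ge0.
      have := qD (z + t *: y) (w + s *: y).
      by rewrite addrACA -scalerDl; lra.
    rewrite -ler_pdivrMl//; apply: lb_le_inf; first by exists (q z).
    move=> _ [t /= t0 <-]; rewrite ler_pdivrMl//.
    apply: (@le_trans _ _ (q (a *: z + (a * t) *: y) - (a * t) * q y)).
      by apply: ge_inf => //; exists (a * t) => //=; rewrite mulr_ge0// ltW.
    have := qZ _ (z + t *: y) a0.
    by rewrite scalerDr scalerA; lra.
  have <- : inf (E x) = q x.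
    have : (fun z => inf (E z)) = q by apply: qmin => // z; exact: ge_inf.
    by move=> /(congr1 (@^~ x)).
  rewrite -lerBrDr; apply: ge_inf => //.
  by exists 1 => /=; rewrite // scale1r mul1r.
have qDE x y : q (x + y) = q x + q y.
  by apply/eqP; rewrite eq_le qD super.
have qN x : q (- x) = - q x by have := qDE x (- x); rewrite subrr q0; lra.
have qZp a x : 0 < a -> q (a *: x) = a * q x.
  move=> a0; apply/eqP; rewrite eq_le qZ//=.
  have ai : 0 < a^-1 by rewrite invr_gt0.
  have := qZ _ (a *: x) ai.
  by rewrite scalerA mulVf ?gt_eqF// scale1r -ler_pdivrMl ?invr_gt0// invrK.
move=> a x y; rewrite qDE; congr (_ + _).
case: (ltgtP a 0) => [a0|a0|->]; last by rewrite scale0r q0 mul0r.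
- rewrite -[a *: x]opprK qN -scaleNr qZp ?oppr_gt0//.
  by rewrite mulNr opprK.
- exact: qZp.
Qed.

(* Zorn's lemma is applied to the sublinear functionals themselves, rather than
   to the linear functionals defined on subspaces. *)
Theorem hahn_banach_sublinear (R : realType) (V : lmodType R) (p : V -> R) :
  sublinear p ->
  exists L : V -> R, (forall a x y, L (a *: x + y) = a * L x + L y) /\
    (forall x, L x <= p x).
Proof.
move=> sp.
pose below (q : V -> R) := sublinear q /\ (forall x, q x <= p x).
pose S := {q | below q}.
(* The order is reversed: a maximal element for Zorn's lemma is a minimal sublinear functional. *)
pose Rel (q r : S) := `[< forall x, sval r x <= sval q x >].
(* This uniform lower bound keeps pointwise infima over chains finite. *)
have lbS (q : S) x : - p (- x) <= sval q x.
  case: q => q [sq qp] /=; apply: le_trans (sublinear_oppr_ge x sq).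
  by rewrite lerN2.
suff : exists q : S, forall r, Rel q r -> r = q.
  move=> [[q [sq qp]] qmin].
  exists q; split => //; apply: minimal_sublinear_linear => // r sr rq.
  have rp x : r x <= p x by exact: le_trans (rq x) (qp x).
  suff /qmin/(congr1 sval) :
    Rel (exist below q (conj sq qp)) (exist below r (conj sr rp)) by [].
  exact/asboolP.
apply: Zorn.
- by move=> q; apply/asboolP.
- move=> q r s /asboolP qr /asboolP rs; apply/asboolP => x.
  exact: le_trans (rs x) (qr x).
- move=> [q Pq] [r Pr] /asboolP qr /asboolP rq; apply: eq_exist => /=.
  by apply/funext => x; apply/eqP; rewrite eq_le qr rq.
- move=> A Atot; have [[q0 Aq0]|A0] := pselect (A !=set0); last first.
    exists (exist below p (conj sp (fun x => lexx (p x)))) => q Aq.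
    by exfalso; apply: A0; exists q.
  pose E x := [set sval q x | q in A].
  have hlE x : has_lbound (E x) by exists (- p (- x)) => _ [q Aq <-]; exact: lbS.
  have E0 x : E x !=set0 by exists (sval q0 x), q0.
  have hiE x : has_inf (E x) by [].
  have st : sublinear (fun x => inf (E x)).
    split=> [x y|a x a0].
      apply/ler_addgt0Pr => e e0; have e2 : 0 < e / 2 by rewrite divr_gt0.
      have [_ [q Aq <-] hq] := inf_adherent e2 (hiE x).
      have [_ [r Ar <-] hr] := inf_adherent e2 (hiE y).
      (* The near-minimisers at [x] and at [y] may differ; the smaller of the two in the chain
         serves at both points. *)
      have [s [As sq sr]] : exists s, [/\ A s, sval s x <= sval q x
          & sval s y <= sval r y].
        have [/asboolP h|/asboolP h] := Atot _ _ Aq Ar.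
          by exists r; split.
        by exists q; split.
      have h1 : inf (E (x + y)) <= sval s (x + y).
        by apply: ge_inf => //; exists s.
      by have [[sD _] _] := svalP s; have := sD x y; lra.
    rewrite -ler_pdivrMl//; apply: lb_le_inf => // _ [q Aq <-].
    rewrite ler_pdivrMl//; apply: (@le_trans _ _ (sval q (a *: x))).
      by apply: ge_inf => //; exists q.
    by have [[_ qZ] _] := svalP q; exact: qZ.
  have tp x : inf (E x) <= p x.
    have [_ q0p] := svalP q0; apply: le_trans (q0p x).
    by apply: ge_inf => //; exists q0.
  exists (exist below (fun x => inf (E x)) (conj st tp)) => q Aq; apply/asboolP => x /=.
  by apply: ge_inf => //; exists q.
Qed.

(** * Measures generated by open covers *)

(** This is positivity of the distance between [A] and [B], the condition under which a metric outer
    measure is additive. *)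
Definition metrically_separated (R : realType) (T : pseudoMetricType R) (A B : set T) :=
  exists2 e : R, 0 < e & forall x y, A x -> B y -> ~ ball x e y.

(* Caratheodory's criterion. The layers [D k] and [A k] of [X `&` G] at
   decreasing distance from the complement of [G] are separated, so that the
   even layers and the odd layers both have a summable mass. *)
Lemma metric_caratheodory (R : realType) (T : pseudoMetricType R)
    (mu : {outer_measure set T -> \bar R}) :
  (forall A B, metrically_separated A B -> (mu A + mu B <= mu (A `|` B))%E) ->
  forall G, open G -> mu.-caratheodory G.
Proof.
move=> mu_sep G oG; apply: le_caratheodory_measurable => X.
have [->|Xoo] := eqVneq (mu X) +oo%E; first by rewrite leey.
pose A k := [set x | X x /\ ball x k.+1%:R^-1 `<=` G].
have A_incr k l : (k <= l)%N -> A k `<=` A l.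
  move=> kl x [Xx xG]; split => //; apply: subset_trans xG; apply: le_ball.
  by rewrite lef_pV2 ?posrE// ler_nat.
have AG k : A k `<=` G by move=> x [_]; apply; exact: ballxx.
have AX k : A k `<=` X by move=> x [].
(* Skipping one index leaves a gap of width [1/(k+1) - 1/(k+2)] between [A k] and [D k]. *)
pose D k := A k.+2 `\` A k.+1.
have sepAD k : metrically_separated (A k) (D k).
  exists (k.+1%:R^-1 - k.+2%:R^-1); first by rewrite subr_gt0 ltf_pV2 ?posrE// ltr_nat.
  move=> x y [_ xG] [[Xy _] nAy] xy; apply: nAy; split => // z yz; apply: xG.
  by rewrite -[X in ball x X](subrK k.+2%:R^-1); exact: ball_triangle xy yz.
(* The layer of index [2n + c] is separated from [A (2n + c)], which contains the earlier layers of
   the same parity, so their masses add up. *)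
have sumD c n : (\sum_(k < n) mu (D (k.*2 + c)%N) <= mu (A (n.*2 + c)%N))%E.
  elim: n => [|n ih]; first by rewrite big_ord0 outer_measure_ge0.
  rewrite big_ord_recr/=; apply: (le_trans (leeD2r _ ih)).
  apply: le_trans (mu_sep _ _ (sepAD _)) _.
  apply: le_outer_measure; rewrite subUset; split.
    by apply: A_incr; rewrite doubleS leqW.
  by rewrite doubleS !addSn; exact: subDsetl.
pose h k := (mu (D k.*2) + mu (D k.*2.+1))%E.
have h0 k : (0 <= h k)%E by rewrite adde_ge0// outer_measure_ge0.
have sumh : (\sum_(0 <= k <oo) h k < +oo)%E.
  apply: (@le_lt_trans _ _ (mu X + mu X)%E); last first.
    by rewrite ltey; move: Xoo (outer_measure_ge0 mu X); case: (mu X).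
  apply: lime_le; first by apply: is_cvg_nneseries.
  apply: nearW => n; rewrite big_mkord big_split/=; apply: leeD.
    apply: le_trans (le_outer_measure mu _ _ (AX (n.*2 + 0)%N)).
    by apply: le_trans (sumD 0%N n); apply: lee_sum => i _; rewrite addn0.
  apply: le_trans (le_outer_measure mu _ _ (AX (n.*2 + 1)%N)).
  by apply: le_trans (sumD 1%N n); apply: lee_sum => i _; rewrite addn1.
(* As [G] is open, each point of [X] in [G] lies in some [A k]. If the least such index [m] exceeds
   [2N + 1], the point lies in the layer [D (m - 2)]. *)
have cover N : X `&` G `<=` A N.*2.+1 `|` \bigcup_(k in ~` `I_N) (D k.*2 `|` D k.*2.+1).
  move=> x [Xx Gx].
  have [k Akx] : exists k, A k x.
    have /nbhs_ballP[e /= e0 xe] : nbhs x G by exact: open_nbhs_nbhs.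
    have [k _ /(_ k (leqnn _))] := near_infty_natSinv_lt (PosNum e0) .
    move=> /= ke; exists k; split => //; apply: subset_trans xe; apply: le_ball.
    exact: ltW.
  have exA : exists k, (fun k => `[< A k x >]) k by exists k; exact/asboolP.
  case: (ex_minnP exA) => m /asboolP Am mmin.
  have [mN|Nm] := leqP m N.*2.+1; first by left; exact: A_incr Am.
  right; case: m Nm Am mmin => [//|[//|m]]; rewrite !ltnS => Nm Am mmin.
  have Dm : D m x.
    by split => // nA; have := mmin m.+1 (asboolT nA); rewrite ltnn.
  exists m./2 => /=.
    by apply/negP; rewrite -leqNgt -(doubleK N) half_leq.
  move: (odd_double_half m) Dm; move: m./2 => j.
  by case: odd => /= <- ?; [right|left].
apply/lee_addgt0Pr => e e0.
have [N tailN] : exists N, (\sum_(N <= k <oo) h k <= e%:E)%E.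
  have := nneseries_tail_cvg sumh (fun k _ => h0 k).
  move=> /fine_cvgP[fin] /cvgrPdist_le /(_ _ e0) cv.
  have [N _ /(_ N (leqnn _))[/= f1 f2]] : \forall N \near \oo,
      (\sum_(N <= k <oo) h k)%E \is a fin_num /\
      `|0 - fine (\sum_(N <= k <oo) h k)%E| <= e.
    by near=> N; split; near: N.
  exists N; rewrite -(fineK f1) lee_fin; apply: le_trans f2.
  by rewrite sub0r normrN ler_norm.
have le1 : (mu (X `&` G) <= mu (A N.*2.+1) + e%:E)%E.
  apply: le_trans (le_outer_measure mu _ _ (cover N)) _.
  apply: le_trans (outer_measureU2 _ _ _) _; apply: leeD => //.
  apply: le_trans (outer_measure_sigma_subadditive_tail _ _ _) _.
  apply: le_trans tailN; apply: lee_nneseries => k *.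
    exact: outer_measure_ge0.
  exact: outer_measureU2.
apply: (le_trans (leeD2r _ le1)); rewrite addeAC; apply: leeD => //.
apply: le_trans (mu_sep _ _ _) _.
  exists N.*2.+2%:R^-1; first by rewrite invr_gt0.
  by move=> x y [_ xG] [_ Gy] /xG.
apply: le_outer_measure; rewrite subUset; split; first exact: AX.
exact: subIsetl.
Unshelve. all: by end_near. Qed.

(* The cost [+oo] of a set that is not open restricts the covers in the outer
   measure [mu_ext] to open ones. *)
Lemma open_content_measure (R : realType) (T : normedModType R) (K : set T)
    (nu : set T -> R) :
  compact K ->
  nu set0 = 0 ->
  (forall A, 0 <= nu A) ->
  (forall A B, A `&` K `<=` B -> nu A <= nu B) ->
  (forall A B, nu (A `|` B) <= nu A + nu B) ->
  (forall A B, A `&` B = set0 -> nu A + nu B <= nu (A `|` B)) ->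
  exists mu : {finite_measure
      set (g_sigma_algebraType (open : set (set T))) -> \bar R},
    [/\ mu (~` K) = 0%E, mu K = (nu setT)%:E &
      forall G, open G -> (mu G <= (nu G)%:E)%E].
Proof.
move=> cptK nu0 nu_ge0 nu_le nuU nuD.
pose B := g_sigma_algebraType (open : set (set T)).
pose cost (A : set B) : \bar R := if `[< open (A : set T) >] then (nu A)%:E else +oo%E.
have costE (A : set T) : open A -> cost A = (nu A)%:E.
  by move=> oA; rewrite /cost; case: asboolP.
have cost0 : cost set0 = 0%E by rewrite costE ?nu0//; exact: open0.
have cost_ge0 A : (0 <= cost A)%E.
  by rewrite /cost; case: ifP => // _; rewrite lee_fin.
pose mu : {outer_measure set T -> \bar R} := HB.pack (mu_ext cost : set T -> \bar R)
  (isOuterMeasure.Build R T (mu_ext cost) (mu_ext0 cost0 cost_ge0)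
    (mu_ext_ge0 cost_ge0) (le_mu_ext cost) (mu_ext_sigma_subadditive cost_ge0)).
have mu_open (G : set T) : open G -> (mu G <= (nu G)%:E)%E.
  move=> oG; apply: ereal_inf_lbound.
  exists (fun n => if n is 0%N then G else set0).
    split=> [[|n]|x Gx]; last by exists 0%N.
    - exact: sub_sigma_algebra.
    - exact: measurable0.
  rewrite (@nneseries_recl _ xpredT (fun n => cost (if n is 0%N then G else set0)))//.
  rewrite eseries_cond eseries0 ?adde0 ?costE//.
  by move=> -[|n]//= _ _; exact: cost0.
have mu_cover (X : set T) (c : \bar R) :
    (forall F : (set T)^nat, (forall i, open (F i)) -> X `<=` \bigcup_i F i ->
      (c <= \sum_(i <oo) (nu (F i))%:E)%E) -> (c <= mu X)%E.
  move=> cF; apply: le_ereal_inf_tmp => _ [F [_ XF] <-].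
  have [oF|] := pselect (forall i, open (F i : set T)).
    apply: le_trans (cF F oF XF) _; apply: lee_nneseries => i *.
      by rewrite lee_fin.
    by rewrite costE.
  move/existsNP => [i noF]; rewrite (eseries_pinfty (k := i)) ?leey//.
    by move=> k _; rewrite -ltNye (lt_le_trans _ (cost_ge0 _)).
  by rewrite /cost; case: asboolP.
(* The [e / 2]-neighbourhoods of [X] and [Y] are disjoint and open. Cutting an open cover with each
   of them splits its cost, by superadditivity of [nu] on disjoint sets. *)
have mu_sep (X Y : set T) : metrically_separated X Y -> (mu X + mu Y <= mu (X `|` Y))%E.
  move=> [e e0 XY]; apply: mu_cover => F oF XYF.
  have e2 : 0 < e / 2 by rewrite divr_gt0.
  pose V (Z : set T) := \bigcup_(x in Z) (ball x (e / 2))^°.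
  have oV Z : open (V Z) by apply: bigcup_open => x _; exact: open_interior.
  have ZV Z : Z `<=` V Z.
    move=> x Zx; exists x => //; rewrite /interior/=; exact: nbhsx_ballx.
  have dV : V X `&` V Y = set0.
    rewrite -subset0 => z [[x Xx /interior_subset xz] [y Yy /interior_subset yz]].
    apply: (XY x y) => //; rewrite [e]splitr; apply: ball_triangle xz _.
    exact: ball_sym.
  have le_muV Z : Z `<=` X `|` Y ->
      (mu Z <= \sum_(i <oo) (nu (F i `&` V Z))%:E)%E.
    move=> ZXY; apply: (@le_trans _ _ (mu (\bigcup_i (F i `&` V Z)))).
      apply: le_outer_measure; rewrite -setI_bigcupl subsetI; split => //.
      exact: subset_trans XYF.
    apply: le_trans (outer_measure_sigma_subadditive _ _) _.
    apply: lee_nneseries => i *; first exact: outer_measure_ge0.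
    by apply: mu_open; exact: openI.
  apply: (le_trans (leeD (le_muV X _) (le_muV Y _))) => //.
  rewrite -nneseriesD; try by move=> *; rewrite lee_fin.
  apply: lee_nneseries => i *; first by rewrite adde_ge0// lee_fin.
  rewrite -EFinD lee_fin; apply: le_trans (nuD _ _ _) _.
    by rewrite setIACA dV setI0.
  by apply: nu_le; rewrite -setIUr => x [[]].
(* Compactness leaves only the first [N] members of an open cover to consider, so that finite
   subadditivity of [nu] is enough. *)
have mu_K : ((nu setT)%:E <= mu K)%E.
  apply: mu_cover => F oF KF.
  move: cptK; rewrite compact_cover => /(_ nat setT F).
  move=> /(_ (fun i _ => oF i) KF)[D _ KD].
  have [N DN] : exists N, forall i, i \in D -> (i < N)%N.
    exists (\max_(i <- enum_fset D) i).+1 => i iD; rewrite ltnS.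
    exact: (@leq_bigmax_seq _ _ xpredT (fun i => i) i iD).
  apply: (@le_trans _ _ (\sum_(0 <= i < N) (nu (F i))%:E)%E); last first.
    by apply: nneseries_lim_ge => i *; rewrite lee_fin.
  apply: (@le_trans _ _ (nu (\big[setU/set0]_(0 <= i < N) F i))%:E).
    rewrite lee_fin; apply: nu_le => x [_ /KD[i iD Fix]].
    rewrite big_mkord -bigcup_mkord; exists i => //=; exact: DN.
  elim/big_ind2 : _ => // [|a b A' B' aA bB]; first by rewrite nu0.
  by apply: le_trans (leeD aA bB); rewrite -EFinD lee_fin.
have clK : closed K by apply: compact_closed => //; exact: norm_hausdorff.
(* The Caratheodory measurable sets form a sigma-algebra containing the open sets, hence all Borel
   sets. *)
have caraB (A : set B) : measurable A -> mu.-caratheodory A.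
  move: A; apply: smallest_sub => [|A oA]; last exact: metric_caratheodory.
  split.
  - exact: caratheodory_measurable_set0.
  - by move=> A cA; rewrite setTD; exact: caratheodory_measurable_setC.
  - exact: caratheodory_measurable_bigcup.
have mu_sigma : semi_sigma_additive (mu : set B -> \bar R).
  move=> F mF tF mUF; apply: caratheodory_measure_sigma_additive => //.
    by move=> i; apply: caraB.
  exact: caraB.
pose m0 : {measure set B -> \bar R} := HB.pack (mu : set B -> \bar R)
  (isMeasure.Build _ _ _ (mu : set B -> \bar R) (outer_measure0 mu)
    (outer_measure_ge0 mu) mu_sigma).
have m0T : (m0 setT < +oo)%E by apply: le_lt_trans (mu_open _ openT) _; rewrite ltry.
(* Restricting to [setT] changes no value; it only records that the total mass is finite. *)
pose m : {finite_measure set B -> \bar R} := mfrestr measurableT m0T.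
have mE A : m A = mu A by rewrite /m/= /mfrestr/= /mrestr setIT.
exists m; split => [||G oG]; rewrite mE; last exact: mu_open.
- apply/eqP; rewrite eq_le outer_measure_ge0 andbT.
  apply: le_trans (mu_open _ _) _; first exact: closed_openC.
  by rewrite lee_fin -nu0; apply: nu_le; rewrite setICl.
- apply/eqP; rewrite eq_le mu_K andbT.
  by apply: le_trans (mu_open _ openT); exact: le_outer_measure.
Qed.

(** * The Riesz representation theorem *)

Definition bounded_on (R : realType) (T : Type) (K : set T) (h : T -> R) :=
  exists M, forall z, K z -> `|h z| <= M.

Lemma bounded_on_lin (R : realType) (T : Type) (K : set T) (a : R) (h k : T -> R) :
  bounded_on K h -> bounded_on K k -> bounded_on K (fun z => a * h z + k z).
Proof.
move=> [M hM] [N kN]; exists (`|a| * M + N) => z Kz.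
rewrite (le_trans (ler_normD _ _))// normrM lerD ?kN//.
by rewrite ler_wpM2l// hM.
Qed.

Lemma bounded_on_cst (R : realType) (T : Type) (K : set T) (c : R) :
  bounded_on K (fun=> c).
Proof. by exists `|c|. Qed.

Lemma bounded_on_indic (R : realType) (T : Type) (K A : set T) :
  bounded_on K (\1_A : T -> R).
Proof. by exists 1 => z _; rewrite indicE; case: (_ \in _); rewrite ?normr1 ?normr0. Qed.

Lemma bounded_on_within_continuous (R : realType) (T : topologicalType)
    (K : set T) (h : T -> R) :
  compact K -> {within K, continuous h} -> bounded_on K h.
Proof.
move=> cK ch; have [M [_ hM]] := compact_bounded (continuous_compact ch cK).
exists (M + 1) => z Kz; apply: hM; first by rewrite ltrDl.
by exists z.
Qed.

(** * Borel measurability and integrability on compact sets *)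

Section borel.
Context (R : realType) (T : normedModType R).
Let B := g_sigma_algebraType (open : set (set T)).

Lemma within_continuous_measurable (K : set T) (h : T -> R) :
  measurable (K : set B) -> {within K, continuous h} ->
  measurable_fun (K : set B) (h : B -> R).
Proof.
move=> mK /continuousP ch; apply: (measurability _ (RGenOInfty.measurableE R)).
move=> _ [_ [a ->] <-].
have /open_subspaceP[V oV VK] := ch _ (@interval_open _ (BRight a) +oo%O isT isT).
rewrite setIC -VK; apply: measurableI => //; exact: sub_sigma_algebra.
Qed.

Lemma compact_borel_measurable (K : set T) : compact K -> measurable (K : set B).
Proof.
move=> cK; rewrite -(setCK K); apply: measurableC; apply: sub_sigma_algebra.
by apply: closed_openC; apply: compact_closed => //; exact: norm_hausdorff.
Qed.

Lemma within_continuous_integrable (K : set T)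
    (mu : {finite_measure set B -> \bar R}) (h : T -> R) :
  compact K -> {within K, continuous h} ->
  mu.-integrable (K : set B) (EFin \o (h : B -> R)).
Proof.
move=> cK ch; have mK := compact_borel_measurable cK.
apply: measurable_bounded_integrable => //.
- by rewrite -ge0_fin_numE//; exact: fin_num_measure.
- exact: within_continuous_measurable.
- have [M hM] := bounded_on_within_continuous cK ch.
  exists M; split; first exact: num_real.
  by move=> N MN z /hM; move/le_trans; apply; exact: ltW.
Qed.

End borel.

(** The sum counts the multiples of [e] among [e, ..., N e] strictly below [y], a layer-cake
    approximation of [y] from below. The induction on [N] removes the lowest layer and passes to
    [y - e]. *)
Lemma floor_sum_bounds (R : realType) (N : nat) (e y : R) : 0 < e -> 0 <= y ->
  let s := e * \sum_(k < N) (k.+1%:R * e < y)%R%:R in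
  s <= y /\ (y <= N.+1%:R * e -> y <= e + s).
Proof.
move=> e0; elim: N y => [|N ih] y y0 /=.
  by rewrite big_ord0 mulr0 addr0 mul1r.
have [ey|ye] := ltP e y.
  have ye0 : 0 <= y - e by rewrite subr_ge0 ltW.
  have [ih1 ih2] := ih _ ye0.
  rewrite big_ord_recl/= mul1r ey mulrDr mulr1.
  rewrite (eq_bigr (fun k : 'I_N => (k.+1%:R * e < y - e)%R%:R)); last first.
    by move=> k _; rewrite /bump/= add1n -[k.+2%:R]natr1 mulrDl mul1r ltrBrDr.
  split; first by lra.
  rewrite -[N.+2%:R]natr1 mulrDl mul1r => yN.
  have := ih2; rewrite lerBlDr => /(_ yN); lra.
rewrite big1 ?mulr0 ?addr0// => k _.
case: ltP => // /lt_geF; rewrite (le_trans ye)//.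
by rewrite -{1}[e]mul1r ler_pM2r// ler1n.
Qed.

Section riesz.
Context (R : realType) (T : normedModType R) (K : set T) (L : (T -> R) -> R).
Hypothesis cptK : compact K.
Hypothesis L_lin : forall a h k, bounded_on K h -> bounded_on K k ->
  L (fun z => a * h z + k z) = a * L h + L k.
Hypothesis L_pos : forall h, bounded_on K h -> (forall z, K z -> 0 <= h z) ->
  0 <= L h.
Let B := g_sigma_algebraType (open : set (set T)).

Let L_le h k : bounded_on K h -> bounded_on K k ->
  (forall z, K z -> h z <= k z) -> L h <= L k.
Proof.
move=> bh bk hk.
have := L_pos (bounded_on_lin (-1) bh bk).
rewrite L_lin// mulN1r addrC subr_ge0; apply => z Kz.
by rewrite mulN1r addrC subr_ge0 hk.
Qed.

Let L0 : L (fun=> 0) = 0.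
Proof.
have b0 := bounded_on_cst K (0 : R).
have := L_lin 1 b0 b0; rewrite !mul1r addr0.
by move/eqP; rewrite addrC -subr_eq subrr => /eqP.
Qed.

Let LD h k : bounded_on K h -> bounded_on K k ->
  L (fun z => h z + k z) = L h + L k.
Proof.
move=> bh bk; rewrite -[L h]mul1r -L_lin//; congr L.
by apply/funext => z; rewrite mul1r.
Qed.

Let LZ a h : bounded_on K h -> L (fun z => a * h z) = a * L h.
Proof.
move=> bh; rewrite -[RHS]addr0 -L0 -L_lin//; last exact: bounded_on_cst.
by congr L; apply/funext => z; rewrite addr0.
Qed.

Let L_sum_indic (O : nat -> set T) N :
  bounded_on K (fun z => \sum_(k < N) \1_(O k) z : R) /\
  L (fun z => \sum_(k < N) \1_(O k) z) = \sum_(k < N) L \1_(O k).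
Proof.
elim: N => [|N [ihb ih]].
  have -> : (fun z : T => \sum_(k < 0) \1_(O k) z : R) = (fun=> 0 : R).
    by apply/funext => z; rewrite big_ord0.
  by rewrite big_ord0 L0; split => //; exact: bounded_on_cst.
have -> : (fun z => \sum_(k < N.+1) \1_(O k) z : R) =
    (fun z => 1 * \sum_(k < N) \1_(O k) z + \1_(O N) z).
  by apply/funext => z; rewrite big_ord_recr/= mul1r.
have bN := bounded_on_indic R K (O N).
by split; [exact: bounded_on_lin|rewrite L_lin// big_ord_recr/= ih mul1r].
Qed.

(** Positivity is tested on [K] alone, so the content [L \1_A] depends only on the trace of [A] on
    [K]. *)
Let dominated_measure : exists mu : {finite_measure set B -> \bar R},
  [/\ mu (~` K) = 0%E, mu K = (L (fun=> 1))%:E &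
    forall G, open G -> (mu G <= (L \1_G)%:E)%E].
Proof.
have bI (A : set T) := bounded_on_indic R K A.
have [||||||mu [mu1 mu2 mu3]] := @open_content_measure R T K (fun A => L \1_A).
- exact: cptK.
- by rewrite -[RHS]L0; congr L; apply/funext => z; rewrite indic0.
- by move=> A; apply: L_pos => // z _; rewrite indicE.
- move=> A C AC; apply: L_le => // z Kz; rewrite !indicE ler_nat.
  by case: (boolP (z \in A)) => [/set_mem Az|//]; rewrite (mem_set (AC z _)).
- move=> A C; rewrite -LD//; apply: L_le => //.
    by have := bounded_on_lin 1 (bI A) (bI C); under eq_fun do rewrite mul1r.
  move=> z Kz; rewrite !indicE in_setU -natrD ler_nat.
  by case: (z \in A); case: (z \in C).
- move=> A C AC0; rewrite -LD//; apply: L_le => //.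
    by have := bounded_on_lin 1 (bI A) (bI C); under eq_fun do rewrite mul1r.
  move=> z Kz; rewrite !indicE in_setU -natrD ler_nat.
  have : z \notin A `&` C by rewrite AC0 in_set0.
  by rewrite in_setI; case: (z \in A); case: (z \in C).
exists mu; split => //; rewrite mu2; congr (L _)%:E.
by apply/funext => z; rewrite indicT.
Qed.

(* An upper bound suffices: [mu K = L 1] turns it into an equality, applied to
   [M + h] and to [- h]. *)
Let integral_le (mu : {finite_measure set B -> \bar R}) (h : T -> R) :
  mu K = (L (fun=> 1))%:E ->
  (forall G, open G -> (mu G <= (L \1_G)%:E)%E) ->
  {within K, continuous h} -> (forall z, K z -> 0 <= h z) ->
  (\int[mu]_(z in K) (h z)%:E <= (L h)%:E)%E.
Proof.
move=> muK muG ch h0.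
have bh := bounded_on_within_continuous cptK ch.
have mopen (G : set T) : open G -> measurable (G : set B).
  by move=> ?; exact: sub_sigma_algebra.
have mK : measurable (K : set B) by exact: compact_borel_measurable.
have L1_ge0 : 0 <= L (fun=> 1) by apply: L_pos => //; exact: bounded_on_cst.
apply/lee_addgt0Pr => d d0.
(* The [+ 1] keeps the denominator positive even if [L] vanishes on the constant 1. *)
pose e := d / (L (fun=> 1) + 1).
have e0 : 0 < e by rewrite divr_gt0// ltr_wpDl.
have eL : e * L (fun=> 1) <= d.
  by rewrite /e mulrAC ler_pdivrMr ?ltr_wpDl// ler_pM2l// lerDl.
have [M hM] := bh.
(* With this [N], the height [(N + 1) e] reaches the bound [M] of [h] on [K]. *)
pose N := Num.truncn (M / e).
have MN : M <= N.+1%:R * e by rewrite -ler_pdivrMr// ltW// truncnS_gt.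
(* Continuity of [h] within [K] makes its superlevel sets traces of open sets, the only sets on
   which [L] is known to dominate [mu]. *)
have [G GP] : {G : nat -> set T & forall k, open (G k) /\
    G k `&` K = (h @^-1` [set t | k.+1%:R * e < t]) `&` K}.
  apply: (@choice _ _ (fun k G => open G /\
    G `&` K = (h @^-1` [set t | k.+1%:R * e < t]) `&` K)) => k.
  move/continuousP : ch => /(_ [set t | k.+1%:R * e < t] (@open_gt _ _)).
  by move=> /open_subspaceP[V oV VK]; exists V.
have opG k := (GP k).1.
have GE k z : K z -> (\1_(G k) z : R) = (k.+1%:R * e < h z)%R%:R.
  move=> Kz; rewrite indicE; congr (nat_of_bool _)%:R.
  have /seteqP[s1 s2] := (GP k).2.
  apply/idP/idP; rewrite inE => zO; first by have [] := s1 z (conj zO Kz).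
  by have [] := s2 z (conj zO Kz).
have mG k : measurable (G k : set B) by exact: mopen.
have [bO LO] := L_sum_indic G N.
(* The layer sum is at most [h], which is used under [L]; that [h] exceeds it by at most [e] is used
   below under the integral. *)
have leL : e * (\sum_(k < N) L \1_(G k)) <= L h.
  rewrite -LO -LZ//; apply: L_le => //.
    have := bounded_on_lin e bO (bounded_on_cst K 0).
    by under eq_fun do rewrite addr0.
  move=> z Kz; under eq_bigr do rewrite GE//.
  by have [] := floor_sum_bounds N e0 (h0 z Kz).
have mI k : measurable_fun (K : set B) (fun z : B => (e * \1_(G k) z)%:E).
  apply/measurable_EFinP; apply: measurable_funM; first exact: measurable_cst.
  apply: (@measurable_indic _ _ R); exact: mG.
have hint : (\int[mu]_(z in K) (h z)%:E <=
    \int[mu]_(z in K) (e%:E + \sum_(k < N) (e * \1_(G k) z)%:E))%E.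
  apply: ge0_le_integral => //.
  - by apply/measurable_EFinP; exact: within_continuous_measurable.
  - by apply: emeasurable_funD => //; apply: emeasurable_fun_sum => k; exact: mI.
  - move=> z Kz; rewrite sumEFin -EFinD lee_fin -mulr_sumr.
    under eq_bigr do rewrite GE//.
    have [_ ->//] := floor_sum_bounds N e0 (h0 z Kz).
    by apply: le_trans MN; apply: le_trans (hM z Kz); exact: ler_norm.
apply: (le_trans hint).
have I0 k z : (0 <= (e * \1_(G k) z)%:E)%E.
  by rewrite lee_fin mulr_ge0// ?ltW// indicE.
rewrite ge0_integralD//; last 3 first.
- by move=> z _; rewrite lee_fin ltW.
- by move=> z _; apply: sume_ge0 => k _.
- by apply: emeasurable_fun_sum => k; exact: mI.
rewrite (_ : (fun=> e%:E) = cst e%:E)// integral_cst//.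
rewrite [X in (e%:E * X)%E]muK addeC; apply: leeD; last first.
  by rewrite -EFinM lee_fin.
rewrite ge0_integral_sum//.
apply: le_trans (_ : ((e * (\sum_(k < N) L \1_(G k)))%:E <= _)%E); last first.
  by rewrite lee_fin.
rewrite mulr_sumr -sumEFin; apply: lee_sum => k _.
under eq_integral do rewrite EFinM.
rewrite ge0_integralZl_EFin//; last first.
- exact: ltW.
- by apply/measurable_EFinP; apply: (@measurable_indic _ _ R); exact: mG.
rewrite (integral_indic mu mK (mG k)).
rewrite [leRHS]EFinM; apply: lee_wpmul2l; first by rewrite lee_fin ltW.
apply: le_trans (muG _ (opG k)).
apply: (le_measure mu _ _ (@subIsetl _ (G k) K)); rewrite inE.
- exact: measurableI.
- exact: mG.
Qed.

Theorem riesz_representation : exists mu : {finite_measure set B -> \bar R},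
  mu (~` K) = 0%E /\
  forall h, {within K, continuous h} -> (\int[mu]_(z in K) (h z)%:E = (L h)%:E)%E.
Proof.
have [mu [muCK muK muG]] := dominated_measure; exists mu; split => //.
have mK : measurable (K : set B) by exact: compact_borel_measurable.
have bint h := @within_continuous_integrable R T K mu h cptK.
(* Adding the bound [M] makes [h] nonnegative; the contributions of [M] cancel because [mu K] equals
   [L] of the constant 1. *)
have le_int h : {within K, continuous h} -> (\int[mu]_(z in K) (h z)%:E <= (L h)%:E)%E.
  move=> ch; have bh := bounded_on_within_continuous cptK ch.
  have [M hM] := bh.
  have cM : {within K, continuous (fun z => M + h z)}.
    by move=> z; apply: cvgD; [exact: cvg_cst|exact: ch].
  have cMc : {within K, continuous (fun=> M)} by move=> z; exact: cvg_cst.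
  have hM0 z : K z -> 0 <= M + h z.
    by move=> /hM; rewrite ler_norml => /andP[+ _]; rewrite -subr_ge0 opprK addrC.
  have := integral_le muK muG cM hM0.
  under eq_integral do rewrite EFinD.
  rewrite (integralD_EFin mK (bint _ cMc) (bint _ ch))/=.
  rewrite (_ : (fun=> M%:E) = cst M%:E)// integral_cst// [X in (M%:E * X)%E]muK -EFinM.
  rewrite LD//; last exact: bounded_on_cst.
  rewrite (_ : (fun=> M) = (fun z : T => M * (fun=> 1) z)); last first.
    by apply/funext => z; rewrite mulr1.
  by rewrite LZ ?EFinD ?leeD2lE//; exact: bounded_on_cst.
move=> h ch; apply/eqP; rewrite eq_le le_int//=.
have cN : {within K, continuous (fun z => -1 * h z)}.
  by move=> z; apply: cvgM; [exact: cvg_cst|exact: ch].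
have := le_int _ cN; rewrite LZ; last exact: bounded_on_within_continuous.
under eq_integral do rewrite EFinM.
rewrite integralZl//; last exact: bint.
by rewrite mulN1r EFinN EFinN mulN1e leeN2.
Qed.

End riesz.

(** * Positive extensions of linear functionals *)

Section bounded_functions.
Context (R : realType) (T : Type) (K : set T).

(** Hahn-Banach is stated for a whole vector space; this predicate carves the bounded functions out
    of [T -> R^o] as a submodule. *)
Definition bounded_pred : {pred T -> R^o} :=
  fun h => `[< bounded_on K (h : T -> R) >].

Lemma bounded_pred_submod_closed : submod_closed bounded_pred.
Proof.
split; first by apply/asboolP; exact: bounded_on_cst.
by move=> a h k /asboolP bh /asboolP bk; apply/asboolP; exact: bounded_on_lin.
Qed.

HB.instance Definition _ :=
  GRing.isSubmodClosed.Build R (T -> R^o) bounded_pred bounded_pred_submod_closed.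

Definition bounded_fun := {h : T -> R^o | h \in bounded_pred}.

HB.instance Definition _ := SubType.on bounded_fun.
HB.instance Definition _ := Choice.on bounded_fun.
HB.instance Definition _ := [SubChoice_isSubLmodule of bounded_fun by <:].

Lemma hahn_banach_bounded (p : (T -> R) -> R) :
  (forall h k, bounded_on K h -> bounded_on K k ->
    p (fun z => h z + k z) <= p h + p k) ->
  (forall a h, 0 < a -> bounded_on K h -> p (fun z => a * h z) <= a * p h) ->
  exists L : (T -> R) -> R,
    (forall a h k, bounded_on K h -> bounded_on K k ->
      L (fun z => a * h z + k z) = a * L h + L k) /\
    (forall h, bounded_on K h -> L h <= p h).
Proof.
move=> pD pZ; have bval (h : bounded_fun) : bounded_on K (val h : T -> R).
  by have /asboolP := valP h.
have [|L [Llin Lp]] := @hahn_banach_sublinear R bounded_fun (fun h => p (val h)).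
  by split=> [h k|a h a0]; [exact: pD|exact: pZ].
have Psub (h : T -> R) : bounded_on K h -> (h : T -> R^o) \in bounded_pred.
  by move=> bh; exact/asboolP.
(* Functions unbounded on [K] are replaced by the default 0; linearity is claimed on bounded ones
   only. *)
pose L' (h : T -> R) := L (insubd (0 : bounded_fun) (h : T -> R^o)).
have L'E h (bh : bounded_on K h) : L' h = L (exist _ (h : T -> R^o) (Psub h bh)).
  by congr L; apply: val_inj; rewrite val_insubd Psub.
exists L'; split=> [a h k bh bk|h bh]; last by rewrite L'E; exact: Lp.
rewrite !L'E; first exact: bounded_on_lin.
by move=> blin; rewrite -Llin; congr L; exact: val_inj.
Qed.

End bounded_functions.

(* The sublinear functional is the value of the perturbed dual program:
   [p h] is the infimum of [s * v + ev i] over the [s >= 0] and [i] such that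
   [h <= s * g + A i] on [K]. *)
Lemma conic_extension (R : realType) (T I : Type) (K : set T) (D : set I)
    (A : I -> T -> R) (ev : I -> R) (g : T -> R) (v : R) (u : I) :
  (forall a i j, D i -> D j -> exists k, [/\ D k,
    forall z, K z -> A k z = a * A i z + A j z & ev k = a * ev i + ev j]) ->
  D u -> (forall z, K z -> A u z = 1) ->
  (forall s i, 0 <= s -> D i -> (forall z, K z -> 0 <= s * g z + A i z) ->
    0 <= s * v + ev i) ->
  bounded_on K g ->
  exists L : (T -> R) -> R,
    [/\ forall a h k, bounded_on K h -> bounded_on K k ->
          L (fun z => a * h z + k z) = a * L h + L k,
        forall h, bounded_on K h -> (forall z, K z -> 0 <= h z) -> 0 <= L h,
        forall i, D i -> bounded_on K (A i) -> L (A i) = ev i &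
        L g <= v].
Proof.
move=> Dlin Du Au1 conic bg.
(* The type [I] has no algebraic structure: the combination [- u + u] supplies an index [w] that
   acts as zero. *)
have [w [Dw Aw evw]] := Dlin (-1) u u Du Du.
have {}Aw z : K z -> A w z = 0 by move=> Kz; rewrite Aw// mulN1r addNr.
have {}evw : ev w = 0 by rewrite evw mulN1r addNr.
pose P h := [set c | exists s i, [/\ 0 <= s, D i,
  forall z, K z -> h z <= s * g z + A i z & c = s * v + ev i]].
have P_neq0 h : bounded_on K h -> P h !=set0.
  move=> [M hM]; have [k [Dk Ak evk]] := Dlin M u w Du Dw.
  exists (0 * v + ev k), 0, k; split => // z Kz.
  rewrite mul0r add0r Ak// Au1// Aw// mulr1 addr0.
  exact: le_trans (ler_norm _) (hM z Kz).
(* Since [h >= - M] on [K], any competitor [(s, i)] for [h] gives [0 <= s * g + A k] with [k]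
   standing for [M u + i], and the cone condition bounds its cost. *)
have P_lb h : bounded_on K h -> has_lbound (P h).
  move=> [M hM]; exists (- (M * ev u)) => _ [s [i [s0 Di hi ->]]].
  have [k [Dk Ak evk]] := Dlin M u i Du Di.
  have : 0 <= s * v + ev k.
    apply: conic => // z Kz; rewrite Ak// Au1// mulr1 addrCA.
    have := hi z Kz; have := hM z Kz; rewrite ler_norml => /andP[]; lra.
  rewrite evk; lra.
have P_inf h : bounded_on K h -> has_inf (P h).
  by move=> bh; split; [exact: P_neq0|exact: P_lb].
have [||L [L_lin L_le]] := @hahn_banach_bounded R T K (fun h => inf (P h)).
- move=> h k bh bk; apply/ler_addgt0Pr => e e0.
  have e2 : 0 < e / 2 by rewrite divr_gt0.
  have [_ [s [i [s0 Di hi ->]]] hs] := inf_adherent e2 (P_inf h bh).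
  have [_ [t [j [t0 Dj kj ->]]] kt] := inf_adherent e2 (P_inf k bk).
  have [l [Dl Al evl]] := Dlin 1 i j Di Dj.
  have : inf (P (fun z => h z + k z)) <= (s + t) * v + ev l.
    apply: ge_inf.
      apply: P_lb; have := bounded_on_lin 1 bh bk.
      by under eq_fun do rewrite mul1r.
    exists (s + t), l; split => //; first by rewrite addr_ge0.
    move=> z Kz; rewrite Al//; have := hi z Kz; have := kj z Kz; lra.
  rewrite evl; lra.
- move=> a h a0 bh; rewrite -ler_pdivrMl//; apply: lb_le_inf; first exact: P_neq0.
  move=> _ [s [i [s0 Di hi ->]]]; rewrite ler_pdivrMl//.
  have [l [Dl Al evl]] := Dlin a i w Di Dw.
  apply: ge_inf.
    apply: P_lb; have := bounded_on_lin a bh (bounded_on_cst K 0).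
    by under eq_fun do rewrite addr0.
  exists (a * s), l; split => //; first by rewrite mulr_ge0// ltW.
    move=> z Kz; rewrite Al// Aw// addr0 -mulrA -mulrDr ler_pM2l//; exact: hi.
  by rewrite evl evw addr0 -mulrA -mulrDr.
have L_P h c : bounded_on K h -> P h c -> L h <= c.
  by move=> bh Phc; apply: le_trans (L_le h bh) _; apply: ge_inf => //; exact: P_lb.
have b0 := bounded_on_cst K (0 : R).
have L0 : L (fun=> 0) = 0.
  have := L_lin 1 _ _ b0 b0; rewrite !mul1r addr0.
  by move/eqP; rewrite addrC -subr_eq subrr => /eqP.
have LN h : bounded_on K h -> bounded_on K (fun z => - h z) /\
    L (fun z => - h z) = - L h.
  move=> bh; have -> : (fun z => - h z) = (fun z => -1 * h z + 0).
    by apply/funext => z; rewrite mulN1r addr0.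
  by split; [exact: bounded_on_lin|rewrite L_lin// L0 addr0 mulN1r].
have L_ev i : D i -> bounded_on K (A i) -> L (A i) <= ev i.
  move=> Di bi; apply: L_P => //; exists 0, i; split => //.
    by move=> z Kz; rewrite mul0r add0r.
  by rewrite mul0r add0r.
(* Each property comes from one competitor: [(0, w)] for [- h], [(0, k)] with [k] standing for [- i]
   for the negative of [A i], and [(1, w)] for [g]. *)
exists L; split => //.
- move=> h bh h0; have [bN LNh] := LN h bh.
  rewrite -oppr_le0 -LNh; apply: L_P => //; exists 0, w; split => //.
    by move=> z Kz; rewrite mul0r add0r Aw// oppr_le0 h0.
  by rewrite mul0r evw addr0.
- move=> i Di bi; apply/eqP; rewrite eq_le L_ev//=.
  have [bN LNi] := LN _ bi; have [k [Dk Ak evk]] := Dlin (-1) i w Di Dw.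
  rewrite -lerN2 -LNi; apply: L_P => //; exists 0, k; split => //.
    by move=> z Kz; rewrite mul0r add0r Ak// Aw// mulN1r addr0.
  by rewrite mul0r add0r evk evw mulN1r addr0.
- by apply: L_P => //; exists 1, w; split => // [z Kz|]; rewrite !mul1r ?Aw// ?evw addr0.
Qed.

(** * The control problem *)

Lemma cvg_lin (R : realType) (T : Type) (F : set_system T) {FF : Filter F}
    (a : R) (h k : T -> R) (lh lk : R) :
  h @ F --> lh -> k @ F --> lk -> a * h x + k x @[x --> F] --> a * lh + lk.
Proof.
by move=> hlh klk; apply: cvgD => //; apply: cvgM => //; exact: cvg_cst.
Qed.

(** * Functions of class C^1 and the operator [opA] *)

Section C1_functions.
Context (R : realType) (n m : nat) (X : set 'rV[R]_n) (U : set 'rV[R]_m).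
Context (lambda : R) (f : 'rV[R]_n * 'rV[R]_m -> 'rV[R]_n).

Lemma C1_cst (c : R) : C1 X (fun=> c).
Proof.
exists setT; first by split; [exact: openT|].
move=> x _; split; first exact: cst_continuous.
move=> i; split; first exact: derivable_cst.
have -> : 'D_('e_i) (fun=> c) = (fun=> 0) :> ('rV[R]_n -> R).
  by apply/funext => y; exact: derive_cst.
exact: cst_continuous.
Qed.

Lemma opA_cst (c : R) z : opA lambda f (fun=> c) z = lambda * c.
Proof.
rewrite /opA big1 ?subr0// => i _.
by rewrite (derive_cst c z.1 ('e_i : 'rV[R]_n)) mul0r.
Qed.

Lemma derivable_lin (a : R) (phi psi : 'rV[R]_n -> R) (x v : 'rV[R]_n) :
  derivable phi x v -> derivable psi x v ->
  derivable (fun y => a * phi y + psi y) x v /\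
  'D_v (fun y => a * phi y + psi y) x = a * 'D_v phi x + 'D_v psi x.
Proof.
move=> dphi dpsi; have daphi := derivableZ (k := a) dphi; split.
  exact: (derivableD daphi dpsi).
by rewrite (deriveD daphi dpsi) (deriveZ a dphi).
Qed.

Lemma C1_lin (a : R) (phi psi : 'rV[R]_n -> R) : C1 X phi -> C1 X psi ->
  C1 X (fun x => a * phi x + psi x).
Proof.
move=> [V1 [oV1 XV1] C1phi] [V2 [oV2 XV2] C1psi].
exists (V1 `&` V2).
  by split; [exact: openI|rewrite subsetI].
move=> x [V1x V2x]; have [cphi dphi] := C1phi x V1x.
have [cpsi dpsi] := C1psi x V2x; split.
  exact: (cvg_lin cphi cpsi).
move=> i; have [dphii cdphii] := dphi i; have [dpsii cdpsii] := dpsi i.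
split; first exact: (derivable_lin a dphii dpsii).1.
rewrite /prop_for /continuous_at (derivable_lin a dphii dpsii).2.
(* Continuity of the derivative at [x] requires its formula on a neighbourhood of [x]. *)
have nO : \near x, a * 'D_('e_i) phi x + 'D_('e_i) psi x =
    'D_('e_i) (fun y => a * phi y + psi y) x.
  have : nbhs x (V1 `&` V2) by apply: open_nbhs_nbhs; split; [exact: openI|].
  apply: filterS => y [V1y V2y].
  by rewrite (derivable_lin a ((C1phi y V1y).2 i).1 ((C1psi y V2y).2 i).1).2.
apply: cvg_trans (near_eq_cvg nO) _.
exact: (cvg_lin cdphii cdpsii).
Qed.

Lemma opA_lin (a : R) (phi psi : 'rV[R]_n -> R) z : C1 X phi -> C1 X psi ->
  X z.1 -> opA lambda f (fun x => a * phi x + psi x) z =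
    a * opA lambda f phi z + opA lambda f psi z.
Proof.
move=> [V1 [_ XV1] C1phi] [V2 [_ XV2] C1psi] Xz.
rewrite /opA mulrBr mulr_sumr addrACA -opprD -big_split/=; congr (_ - _).
  by ring.
apply: eq_bigr => i _.
have [_ /(_ i)[dphi _]] := C1phi _ (XV1 _ Xz).
have [_ /(_ i)[dpsi _]] := C1psi _ (XV2 _ Xz).
by rewrite (derivable_lin a dphi dpsi).2; ring.
Qed.

Lemma opA_continuous (phi : 'rV[R]_n -> R) :
  {within X `*` U, continuous f} -> C1 X phi ->
  {within X `*` U, continuous (opA lambda f phi)}.
Proof.
move=> cf [V [_ XV] C1phi].
have cfst (psi : 'rV[R]_n -> R) : (forall x, X x -> {for x, continuous psi}) ->
    {within X `*` U, continuous (fun z : 'rV[R]_n * 'rV[R]_m => psi z.1)}.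
  move=> cpsi; apply: continuous_in_subspaceT => z; rewrite inE => -[Xz _].
  by apply: (@cvg_comp _ _ _ fst psi _ _ _ _ (cpsi _ Xz)); exact: cvg_fst.
have csum (s : seq 'I_n) : {within X `*` U, continuous
    (fun z => \sum_(i <- s) 'D_('e_i) phi z.1 * f z 0 i)}.
  elim: s => [|i s ih].
    under [X in {within _, continuous X}]eq_fun do rewrite big_nil.
    by move=> z; exact: cvg_cst.
  under [X in {within _, continuous X}]eq_fun do rewrite big_cons.
  move=> z; apply: cvgD; last exact: ih.
  apply: cvgM.
    exact: (cfst _ (fun x Xx => ((C1phi x (XV x Xx)).2 i).2) z).
  have ci := @coord_continuous R 1 n 0 i (f z).
  exact: (@cvg_comp _ _ _ f (fun M : 'rV[R]_n => M 0 i) _ _ _ (cf z) ci).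
move=> z; apply: cvgB; last exact: csum.
apply: cvgM; first exact: cvg_cst.
exact: (cfst _ (fun x Xx => (C1phi x (XV x Xx)).1) z).
Qed.

End C1_functions.

(** * Weak and strong duality *)

Section duality.
Context (R : realType) (n m : nat) (X : set 'rV[R]_n) (U : set 'rV[R]_m).
Context (lambda : R) (f : 'rV[R]_n * 'rV[R]_m -> 'rV[R]_n).
Context (g : 'rV[R]_n * 'rV[R]_m -> R) (x0 : 'rV[R]_n).
Hypothesis cptX : compact X.
Hypothesis cptU : compact U.
Hypothesis cf : {within X `*` U, continuous f}.
Hypothesis cg : {within X `*` U, continuous g}.
Hypothesis lambda_gt0 : 0 < lambda.

Let K := X `*` U.
Let cptK : compact K. Proof. exact: compact_setX. Qed.
Let T : normedModType R := ('rV[R]_n * 'rV[R]_m)%type.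
Let mK : measurable (K : set (borel_space R n m)).
Proof. exact: (@compact_borel_measurable R T K cptK). Qed.

Let dual_feasible := [set phi : 'rV[R]_n -> R | C1 X phi /\
  forall z, K z -> opA lambda f phi z <= g z].

(** By feasibility [phi x0] is the integral of [opA lambda f phi], whose integrand is at most [g] on
    [K]. *)
Let weak_duality phi mu : dual_feasible phi -> feasible X U lambda f x0 mu ->
  ((phi x0)%:E <= pairing K mu g)%E.
Proof.
move=> [Cphi phig] [_ feas]; rewrite -(feas phi Cphi).
apply: le_integral => //.
- exact: (@within_continuous_integrable R T K mu _ cptK (opA_continuous cf Cphi)).
- exact: (@within_continuous_integrable R T K mu _ cptK cg).
- by move=> z; rewrite inE => Kz; rewrite lee_fin; exact: phig.
Qed.

Lemma strong_duality mu0 : feasible X U lambda f x0 mu0 ->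
  dual_value X U lambda f g x0 = primal_value X U lambda f g x0.
Proof.
move=> feas0; have bg := bounded_on_within_continuous cptK cg.
pose D := [set phi x0 | phi in dual_feasible].
have D0 : D !=set0.
  have [M gM] := bg.
  (* [opA] sends this constant to [- M], which lies below [g] on [K]. *)
  exists ((fun=> - (M / lambda)) x0), (fun=> - (M / lambda)) => //; split.
    exact: C1_cst.
  move=> z Kz; rewrite opA_cst mulrN mulrCA mulfV ?gt_eqF// mulr1.
  by have := gM z Kz; rewrite ler_norml => /andP[].
have mu0g : pairing K mu0 g \is a fin_num.
  exact: (integrable_fin_num mK
    (@within_continuous_integrable R T K mu0 _ cptK cg)).
(* Weak duality against [mu0] makes the dual value a real number. *)
have Dub : has_ubound D.
  exists (fine (pairing K mu0 g)) => _ [phi dphi <-].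
  by rewrite -lee_fin fineK//; exact: weak_duality.
have dualE : dual_value X U lambda f g x0 = (sup D)%:E.
  by rewrite -ereal_sup_EFin// /D image_comp.
apply/eqP; rewrite eq_le; apply/andP; split.
  apply: ge_ereal_sup => _ [phi dphi <-]; apply: le_ereal_inf_tmp => _ [mu fmu <-].
  exact: weak_duality.
rewrite dualE.
(* The role of [u], whose image is 1, is played by the constant [lambda^-1]. *)
have [|||||L [L_lin L_pos L_A L_g]] := @conic_extension R T _ K (C1 X)
  (opA lambda f) (fun phi => phi x0) g (sup D) (fun=> lambda^-1).
- move=> a phi psi Cphi Cpsi; exists (fun x => a * phi x + psi x); split => //.
    exact: C1_lin.
  by move=> z [Xz _]; exact: (@opA_lin R n m X lambda f a phi psi z Cphi Cpsi Xz).
- exact: C1_cst.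
- by move=> z _; rewrite opA_cst mulfV// gt_eqF.
(* Cone condition: for [s = 0], [phi x0] is the integral of a nonnegative function against [mu0];
   for [s > 0], [- s^-1 * phi] is dual feasible. *)
- move=> s phi; rewrite le_eqVlt => /predU1P[<-|s0] Cphi Aphi.
    rewrite mul0r add0r -lee_fin -(feas0.2 phi Cphi); apply: integral_ge0 => z Kz.
    by rewrite lee_fin; have := Aphi z Kz; rewrite mul0r add0r.
  have : - s^-1 * phi x0 <= sup D.
    (* The added zero function gives the multiple of [phi] the shape required by [C1_lin] and
       [opA_lin]. *)
    apply: ub_le_sup => //; exists (fun x => - s^-1 * phi x + (fun=> 0) x).
      split; first by apply: C1_lin => //; exact: C1_cst.
      move=> z Kz; rewrite (@opA_lin R n m X lambda f _ phi _ z Cphi (C1_cst X 0) Kz.1).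
      rewrite opA_cst mulr0 addr0 mulNr lerNl -ler_pdivrMl ?invr_gt0// invrK.
      by have := Aphi z Kz; lra.
    by rewrite addr0.
  by rewrite mulNr lerNl ler_pdivlMl// mulrN; lra.
- exact: bg.
have [mu [muCK muL]] := @riesz_representation R T K L cptK L_lin L_pos.
have feas : feasible X U lambda f x0 mu.
  split=> // phi Cphi; have cA := @opA_continuous R n m X U lambda f phi cf Cphi.
  rewrite /adjointA /pairing (muL _ cA) L_A//.
  exact: bounded_on_within_continuous.
apply: (@le_trans _ _ (pairing K mu g)).
  by apply: ereal_inf_lbound; exists mu.
by rewrite /pairing (muL _ cg) lee_fin.
Qed.

End duality.

Theorem mainTheorem2 (R : realType) (n m : nat)
    (X : set 'rV[R]_n) (U : set 'rV[R]_m)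
    (hX : compact X) (hU : compact U)
    (f : 'rV[R]_n * 'rV[R]_m -> 'rV[R]_n)
    (g : 'rV[R]_n * 'rV[R]_m -> R)
    (hf : bounded_continuous_lipschitz U f)
    (hg : bounded_continuous_lipschitz U g)
    (lambda : R) (hlambda : 0 < lambda)
    (x0 : 'rV[R]_n) (hx0 : X x0)
    (hfeas : exists mu, feasible X U lambda f x0 mu) :
  dual_value X U lambda f g x0 = primal_value X U lambda f g x0.
Proof.
have [mu0 feas0] := hfeas.
have XU : X `*` U `<=` setT `*` U by move=> z [_ Uz]; split.
have [_ cf _] := hf; have [_ cg _] := hg.
have cfX := continuous_subspaceW XU cf.
have cgX := continuous_subspaceW XU cg.
exact: (strong_duality hX hU cfX cgX hlambda feas0).
Qed.
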